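(* Let $G=(X\sqcup Y,E)$ be a connected bipartite graph with parts $X$ and $Y$ of sizes $|X|=m$ and $|Y|=n$. Let $\tau(G)$ denote the number of spanning trees of $G$. Then \[ \tau(G)\le \frac{1}{mn}\prod_{v\in V(G)}\deg(v). \] Moreover, equality holds if and only if $G$ is a Ferrers graph.
   Context: A bipartite graph $G=(X\sqcup Y,E)$ is called a Ferrers graph if, after ordering $X=\{x_1,\dots,x_m\}$ and $Y=\{y_1,\dots,y_n\}$, there exist integers $m=t_1\ge t_2\ge\cdots\ge t_n\ge 1$ such that the neighborhood of $y_j$ is $N(y_j)=\{x_1,\dots,x_{t_j}\}$ for each $1\le j\le n$. Equivalently, the neighborhoods of the vertices on one side of the bipartition are linearly ordered by inclusion. *)

(* Defs.v *)
From HB Require Import structures.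
From mathcomp Require Import all_boot all_order all_algebra.

Set Implicit Arguments.
Unset Strict Implicit.
Unset Printing Implicit Defensive.

Record sgraph (V : finType) := SGraph {
  adj :> rel V;
  adj_sym : symmetric adj;
  adj_irrefl : irreflexive adj
}.

Section Graphs.
Variable V : finType.
Implicit Types (e : rel V) (G : sgraph V) (X Y : {set V}) (F : {set {set V}}).

Definition neighborhood G (v : V) : {set V} := [set w | G v w].

Definition deg G (v : V) : nat := #|neighborhood G v|.

Definition edges G : {set {set V}} :=
  [set [set p.1; p.2] | p : V * V & G p.1 p.2].

Definition connected e : bool := [forall u, forall v, connect e u v].

(* A duplicate-free sequence has size at most #|V|, so the bound on k loses no
   cycle; see acyclicP. *)
Definition acyclic e : bool :=
  [forall k : 'I_#|V|.+1, forall c : k.-tuple V, (2 < k) ==> ~~ ucycleb e c].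

Lemma acyclicP e :
  reflect (forall c : seq V, ucycle e c -> size c <= 2) (acyclic e).
Proof.
apply: (iffP forallP) => [H c ec | H k].
  rewrite leqNgt; apply/negP => c2.
  have sc : size c < #|V|.+1.
    by case/andP: ec => _ uc; rewrite ltnS -(card_uniqP uc) max_card.
  by have /forallP/(_ (in_tuple c))/implyP/(_ c2)/negP := H (Ordinal sc); apply.
apply/forallP => c; apply/implyP => k2; apply/negP => ec.
by have := H c ec; rewrite size_tuple leqNgt k2.
Qed.

Definition is_tree e : bool := connected e && acyclic e.

(* The adjacency relation of the spanning subgraph (V, F); for F \subset edges G
   it has no loops, since [set u; u] is not an edge of G. *)
Definition edge_rel F : rel V := [rel u v | [set u; v] \in F].

Definition spanning_trees G : {set {set {set V}}} :=
  [set F : {set {set V}} | (F \subset edges G) && is_tree (edge_rel F)].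

Definition tau G : nat := #|spanning_trees G|.

Definition bipartition G X Y : Prop :=
  [/\ [disjoint X & Y], X :|: Y = [set: V]
    & forall u v, G u v -> (u \in X) && (v \in Y) || (u \in Y) && (v \in X)].

(* Indices start at 0: x i and y j are the vertices x_{i+1} and y_{j+1}, and
   t j is t_{j+1}. *)
Definition ferrers G X Y : Prop :=
  exists (x : 'I_#|X| -> V) (y : 'I_#|Y| -> V) (t : 'I_#|Y| -> nat),
    [/\ injective x /\ [set x i | i : 'I_#|X|] = X,
        injective y /\ [set y j | j : 'I_#|Y|] = Y,
        forall j, nat_of_ord j = 0 -> t j = #|X|,
        (forall j k : 'I_#|Y|, j <= k -> t k <= t j) /\ (forall j, 1 <= t j)
      & forall j, neighborhood G (y j) = [set x i | i : 'I_#|X| & i < t j]].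

End Graphs.

(* Main.v *)
Require Import Defs.
From HB Require Import structures.
From mathcomp Require Import all_boot all_order all_algebra.
From mathcomp Require Import perm ring lra.

Set Implicit Arguments.
Unset Strict Implicit.
Unset Printing Implicit Defensive.

Import Order.TTheory GRing.Theory Num.Theory.
Local Open Scope ring_scope.

(** Order X as x_0, ..., x_(m-1) by decreasing degree.  The Schur complement of
    the Laplacian onto X is the sum over y in Y of the orthogonal projections
    onto the mean-zero functions on N(y).  Up to constants, consider the Helmert
    basis w_k = k e_k - (e_0 + ... + e_(k-1)), k >= 1.  Hadamard's inequality in
    this orthogonal basis gives m tau(G) <= prod_y deg(y) * prod_(k>=1) delta_k,
    where delta_k is the quadratic form at w_k / |w_k|; put delta_0 = n.  If a set
    S = N(y) has c elements among the first l vertices of X, then its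
    contribution to sum_(k>=l) delta_k is
      (|S| - c) - (|S| - c) / |S| * (l - c) / l  <=  |S \ {x_0, ..., x_(l-1)}|,
    so (delta_k) majorizes the degree sequence of X, with the same sum, whence
    prod delta_k <= prod deg(x_k) by Abel summation and AM-GM.  Equality forces
    all the defects (|S| - c) (l - c) to vanish, that is, every N(y) is an
    initial segment of X; conversely the Helmert basis is then an eigenbasis. *)

(** * Determinants *)

Section Determinants.

(** A permutation with a nonzero term never raises [rk]; since it preserves the sum of [rk], it
    cannot lower it anywhere either, so it is the identity. *)
Lemma det_trig_rank (R : comNzRingType) n (A : 'M[R]_n) (rk : 'I_n -> nat) :
  (forall i j, A i j != 0 -> i = j \/ (rk j < rk i)%N) ->
  \det A = \prod_i A i i.
Proof.
move=> trigA; rewrite /determinant (bigD1 (1%g : 'S_n)) //= [X in _ + X]big1 ?addr0.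
  by rewrite odd_perm1 mul1r; apply: eq_bigr => i _; rewrite perm1.
move=> s s1; have [/forallP nz|] := boolP [forall i, A i (s i) != 0]; last first.
  rewrite negb_forall => /existsP[i]; rewrite negbK => /eqP Ai.
  by rewrite (bigD1 i) //= Ai mul0r mulr0.
case/negP: s1; apply/eqP/permP => i; rewrite perm1.
have le j : (rk (s j) <= rk j)%N by case: (trigA _ _ (nz j)) => [<-//|/ltnW].
have sumE : (\sum_j rk (s j) = \sum_j rk j)%N.
  by rewrite [RHS](reindex_inj (@perm_inj _ s)).
case: (trigA _ _ (nz i)) => [//|lti].
have : (\sum_j rk (s j) < \sum_j rk j)%N.
  rewrite (bigD1 i) //= [X in (_ < X)%N](bigD1 i) //= -addSn.
  by apply: leq_add => //; apply: leq_sum.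
by rewrite sumE ltnn.
Qed.

(** Induction by Schur complement: for a pivot a > 0, det M = a det S with S = N - u^T u / a, which
    is again positive semidefinite and has a diagonal bounded by that of N. *)
Lemma hadamard (R : realFieldType) n (M : 'M[R]_n) :
  M^T = M -> (forall x : 'rV_n, 0 <= (x *m M *m x^T) 0 0) ->
  \det M <= \prod_i M i i.
Proof.
elim: n M => [|n IH]; first by move=> M _ _; rewrite det_mx00 big_ord0.
rewrite -[n.+1]/(1 + n)%N => M symM psdM.
pose a := M 0 0; pose u := ursubmx M.
pose N := drsubmx M.
have ulE : ulsubmx M = a%:M.
  apply/matrixP => i j; rewrite !ord1 !mxE eqxx mulr1n /a.
  by congr (M _ _); apply: val_inj.
have dlE : dlsubmx M = u^T.
  by rewrite /u -{1}symM; apply/matrixP => i j; rewrite !mxE.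
have ME : M = block_mx a%:M u u^T N by rewrite -ulE -dlE submxK.
have NE i : N i i = M (lift 0 i) (lift 0 i).
  by rewrite !mxE; congr (M _ _); apply: val_inj.
have symN : N^T = N.
  by rewrite /N -{2}symM; apply/matrixP => i j; rewrite !mxE.
have qE t (x : 'rV_n) : (row_mx (t%:M : 'M_1) x *m M *m (row_mx t%:M x)^T) 0 0
   = t ^+ 2 * a + 2 * t * (u *m x^T) 0 0 + (x *m N *m x^T) 0 0.
  rewrite ME mul_row_block tr_row_mx mul_row_col mulmxDl tr_scalar_mx.
  rewrite mul_scalar_mx scale_scalar_mx mulmxDl -!scalar_mxM !mul_mx_scalar.
  rewrite mul_scalar_mx -scalemxAl.
  have -> : x *m u^T = (u *m x^T)^T by rewrite trmx_mul trmxK.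
  by move: (u *m x^T) (x *m N *m x^T) => w z; rewrite !mxE eqxx mulr1n; ring.
have a_ge0 : 0 <= a.
  have := psdM (row_mx 1%:M 0); rewrite qE trmx0 !mulmx0 !mxE.
  by rewrite expr1n mul1r mulr0 !addr0.
have psdN (x : 'rV_n) : 0 <= (x *m N *m x^T) 0 0.
  by have := psdM (row_mx 0%:M x); rewrite qE expr0n /= mulr0 !mul0r !add0r.
have N_ge0 i : 0 <= N i i.
  have := psdN (delta_mx 0 i); rewrite -rowE trmx_delta.
  by rewrite -colE !mxE.
rewrite big_ord_recl -/a.
have [a0|an0] := eqVneq a 0.
  suff u0 : u = 0 by rewrite ME u0 trmx0 a0 det_ublock det_mx11 !mxE /= !mul0r.
  apply/rowP => j; rewrite [RHS]mxE; apply/eqP; apply: contraT => uj.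
  (* With this first coordinate next to the basis vector e_j, the form takes the value -1. *)
  have := psdM (row_mx (- (N j j + 1) / (2 * u 0 j))%:M (delta_mx 0 j)).
  rewrite qE a0 -rowE trmx_delta -!colE ![(col _ _) _ _]mxE ![(row _ _) _ _]mxE.
  have -> : 2 * (- (N j j + 1) / (2 * u 0 j)) * u 0 j = - (N j j + 1).
    by field.
  by lra.
have a_gt0 : 0 < a by rewrite lt_def an0.
pose S := N - a^-1 *: (u^T *m u).
have -> : \det M = a * \det S.
  have : \det (block_mx 1%:M 0 (- a^-1 *: u^T) 1%:M *m M) = a * \det S.
    rewrite ME mulmx_block !mul1mx !mul0mx !addr0 mul_mx_scalar scalerA.
    rewrite mulrN divff // scaleN1r addNr det_ublock det_scalar1.
    by congr (_ * \det _); rewrite /S addrC scaleNr mulNmx -scalemxAl.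
  by rewrite det_mulmx det_lblock !det1 mul1r mul1r.
have SE i : S i i = N i i - (u 0 i) ^+ 2 / a.
  by rewrite !mxE big_ord1 !mxE; field.
under eq_bigr => i _ do rewrite -NE.
rewrite ler_pM2l //.
have psdS (x : 'rV_n) : 0 <= (x *m S *m x^T) 0 0.
  (* This first coordinate minimizes the form for fixed x, and the minimum is x S x^T. *)
  have := psdM (row_mx (- a^-1 * (u *m x^T) 0 0)%:M x); rewrite qE.
  congr (0 <= _); rewrite /S mulmxBr mulmxBl -scalemxAr -scalemxAl mulmxA.
  have -> : x *m u^T = (u *m x^T)^T by rewrite trmx_mul trmxK.
  rewrite -(mulmxA _ u); move: (u *m x^T) (x *m N *m x^T) => w z.
  have -> : w^T *m w = (w 0 0 ^+ 2)%:M.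
    by apply/matrixP => i j; rewrite !ord1 !mxE big_ord1 !mxE eqxx.
  by rewrite !mxE eqxx mulr1n; field.
have symS : S^T = S.
  by rewrite /S linearB /= linearZ /= symN trmx_mul trmxK.
apply: le_trans (IH _ symS psdS) _; apply: ler_prod => i _.
apply/andP; split.
  have := psdS (delta_mx 0 i).
  by rewrite -rowE trmx_delta -colE mxE [X in 0 <= X -> _]mxE.
by rewrite SE lerBlDr lerDl divr_ge0 ?sqr_ge0.
Qed.

(** * Matrices indexed by a finite type *)

Variable T : finType.

Definition fmx (R : nzRingType) (F : T -> T -> R) : 'M[R]_#|T| :=
  \matrix_(i, j) F (enum_val i) (enum_val j).

Lemma big_enum_valT (R : Type) (idx : R) (op : Monoid.com_law idx) (F : T -> R) :
  \big[op/idx]_(i < #|T|) F (enum_val i) = \big[op/idx]_x F x.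
Proof. exact: esym (big_enum_val F). Qed.

Lemma eq_fmx (R : nzRingType) (F H : T -> T -> R) : F =2 H -> fmx F = fmx H.
Proof. by move=> FH; apply/matrixP => i j; rewrite !mxE FH. Qed.

Lemma tr_fmx (R : nzRingType) (F : T -> T -> R) :
  (fmx F)^T = fmx (fun u v => F v u).
Proof. by apply/matrixP => i j; rewrite !mxE. Qed.

Lemma mul_fmx (R : nzRingType) (F H : T -> T -> R) :
  fmx F *m fmx H = fmx (fun u v => \sum_w F u w * H w v).
Proof.
apply/matrixP => i j; rewrite !mxE -big_enum_valT.
by apply: eq_bigr => k _; rewrite !mxE.
Qed.

Lemma det_fmx_trig (R : comNzRingType) (F : T -> T -> R) (rk : T -> nat) :
  (forall u v, F u v != 0 -> u = v \/ (rk v < rk u)%N) ->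
  \det (fmx F) = \prod_u F u u.
Proof.
move=> trigF; rewrite (@det_trig_rank _ _ _ (fun i => rk (enum_val i))).
  by rewrite -big_enum_valT; apply: eq_bigr => i _; rewrite mxE.
by move=> i j; rewrite mxE => /trigF [/enum_val_inj|]; [left|right].
Qed.

Lemma det_fmx_ker (R : idomainType) (F : T -> T -> R) (z : T -> R) u0 :
  z u0 != 0 -> (forall u, \sum_v F u v * z v = 0) -> \det (fmx F) = 0.
Proof.
move=> z0 Fz; apply/eqP; rewrite -det_tr; apply/det0P.
exists (\row_i z (enum_val i)).
  apply/eqP => /rowP/(_ (enum_rank u0)); rewrite !mxE enum_rankK => /eqP.
  by rewrite (negPf z0).
apply/rowP => j; rewrite mxE [RHS]mxE -[RHS](Fz (enum_val j)) -[RHS]big_enum_valT.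
by apply: eq_bigr => i _; rewrite !mxE mulrC.
Qed.

(** Hadamard's inequality for the Gram matrix P L P^T, whose diagonal entries are the factors on the
    right. *)
Lemma hadamard_fmx (R : realFieldType) (P L : T -> T -> R) :
  (forall u v, L u v = L v u) ->
  (forall z : T -> R, 0 <= \sum_u z u * \sum_v L u v * z v) ->
  \det (fmx P) ^+ 2 * \det (fmx L) <=
  \prod_u \sum_v P u v * \sum_w L v w * P u w.
Proof.
move=> symL psdL.
have -> : \det (fmx P) ^+ 2 * \det (fmx L) = \det (fmx P *m fmx L *m (fmx P)^T).
  by rewrite !det_mulmx det_tr expr2 mulrAC.
apply: le_trans (hadamard _ _) _ => [|x|].
- rewrite !trmx_mul trmxK mulmxA; congr (_ *m _ *m _).
  by rewrite tr_fmx; apply: eq_fmx => u v; rewrite symL.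
- have -> : x *m (fmx P *m fmx L *m (fmx P)^T) *m x^T =
            (x *m fmx P) *m fmx L *m (x *m fmx P)^T.
    by rewrite trmx_mul !mulmxA.
  move: (x *m fmx P) => {}x; have := psdL (fun u => x 0 (enum_rank u)).
  congr (0 <= _); rewrite -mulmxA mxE -[LHS]big_enum_valT.
  apply: eq_bigr => i _; rewrite enum_valK; congr (_ * _).
  rewrite mxE -[LHS]big_enum_valT; apply: eq_bigr => j _.
  by rewrite !mxE enum_valK.
rewrite -mulmxA tr_fmx !mul_fmx -big_enum_valT.
by under eq_bigr => i _ do rewrite mxE.
Qed.

End Determinants.

(** * The matrix-tree theorem *)

(** Multilinearity in the rows: [f] records the term chosen in each row. *)
Lemma det_fmx_sum_rows (R : comNzRingType) (T K : finType) (c : T -> K -> R)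
    (b : T -> K -> T -> R) :
  \det (fmx (fun u v => \sum_k c u k * b u k v)) =
  \sum_(f : {ffun T -> K})
     (\prod_u c u (f u)) * \det (fmx (fun u v => b u (f u) v)).
Proof.
rewrite /determinant; under [RHS]eq_bigr => f _ do rewrite mulr_sumr.
rewrite exchange_big /=; apply: eq_bigr => s _.
pose t u := enum_val (s (enum_rank u)).
transitivity ((-1) ^+ s * \prod_u \sum_k c u k * b u k (t u)).
  congr (_ * _); rewrite -[RHS]big_enum_valT; apply: eq_bigr => i _.
  by rewrite mxE /t enum_valK.
rewrite bigA_distr_bigA mulr_sumr; apply: eq_bigr => f _.
rewrite big_split /= mulrCA; congr (_ * (_ * _)).
by rewrite -[LHS]big_enum_valT; apply: eq_bigr => i _; rewrite mxE /t enum_valK.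
Qed.

Section MatrixTree.
Variables (V : finType) (G : sgraph V) (r : V).
Implicit Types (f : V -> V) (F : {set {set V}}).

Lemma rank_to_root f : (forall u, fconnect f u r) ->
  exists rk : V -> nat, forall u, u != r -> (rk (f u) < rk u)%N.
Proof.
move=> fr; have reach u : exists k, iter k f u == r.
  by exists (findex f u r); rewrite iter_findex.
exists (fun u => ex_minn (reach u)) => u ur.
case: ex_minnP => a _ mina; case: ex_minnP => [[|k]] /= fk _.
  by rewrite fk in ur.
by rewrite ltnS mina // -iterSr.
Qed.

(** This is the minor that one choice [f] of parents contributes to the matrix-tree expansion. If
    all vertices reach [r], the number of steps to [r] makes it triangular with unit diagonal;
    otherwise it is singular. *)
Lemma det_functional (R : idomainType) f : f r = r ->
  \det (fmx (fun u v => (u == v)%:R - ((f u != r) && (v == f u))%:R : R)) =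
  [forall u, fconnect f u r]%:R.
Proof.
move=> frr; case: (boolP [forall u, _]) => [/forallP fr|]; last first.
  (* The indicator of the vertices that do not reach r is in the kernel. *)
  rewrite negb_forall => /existsP[u0 u0r].
  apply: (@det_fmx_ker _ _ _ (fun u => (~~ fconnect f u r)%:R) u0).
    by rewrite u0r oner_eq0.
  move=> u; under eq_bigr => v _ do rewrite mulrBl.
  rewrite sumrB (bigD1 u) //= eqxx mul1r big1 ?addr0; last first.
    by move=> v vu; rewrite eq_sym (negPf vu) mul0r.
  rewrite (bigD1 (f u)) //= eqxx andbT [X in _ - (_ + X)]big1 ?addr0; last first.
    by move=> v vu; rewrite (negPf vu) andbF mul0r.
  apply/eqP; rewrite subr_eq0; apply/eqP.
  have [fur|fur] /= := eqVneq (f u) r.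
    by rewrite mul0r (connect_trans (fconnect1 f u)) // fur connect0.
  rewrite mul1r; congr (~~ _)%:R; apply/idP/idP => [ur|]; last first.
    exact: connect_trans (fconnect1 f u).
  have <- := iter_findex ur; case: (findex f u r) (iter_findex ur) => [ur0|k _].
    by rewrite -[u in f u]/(iter 0 f u) ur0 frr eqxx in fur.
  by rewrite iterSr fconnect_iter.
have [rk rkP] := rank_to_root fr.
have ltfu u : f u != r -> (rk (f u) < rk u)%N.
  by move=> fur; apply: rkP; apply: contraNneq fur => ->; rewrite frr.
rewrite (@det_fmx_trig _ _ _ rk) => [|u v].
  rewrite big1 // => u _; rewrite eqxx; case: (boolP (_ && _)); rewrite ?subr0 //.
  by case/andP=> /ltfu lt /eqP E; rewrite -E ltnn in lt.
have [->|_] := eqVneq u v; first by left.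
case: (boolP (_ && _)); rewrite ?subrr ?eqxx // => /andP[/ltfu lt /eqP ->].
by right.
Qed.

(** The parent map of a spanning tree rooted at [r]. Fixing [r] makes the map total, and each tree
    then has exactly one parent map. *)
Definition arborescence f : bool :=
  [&& f r == r, [forall u, (u != r) ==> G u (f u)]
    & [forall u, fconnect f u r]].

Definition tree_of f : {set {set V}} := [set [set u; f u] | u in [set~ r]].

Lemma set2_inj (a b u v : V) :
  [set a; b] = [set u; v] -> a = u /\ b = v \/ a = v /\ b = u.
Proof.
move=> E.
have /set2P aE : a \in [set u; v] by rewrite -E set21.
have /set2P bE : b \in [set u; v] by rewrite -E set22.
have /set2P uE : u \in [set a; b] by rewrite E set21.
have /set2P vE : v \in [set a; b] by rewrite E set22.
by intuition congruence.
Qed.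

Lemma edge_rel_sym F : symmetric (edge_rel F).
Proof. by move=> u v; rewrite /edge_rel /= setUC. Qed.

Lemma tree_ofP f u v :
  reflect (u != r /\ v = f u \/ v != r /\ u = f v) (edge_rel (tree_of f) u v).
Proof.
apply: (iffP imsetP) => [[w]|[[ur ->]|[vr ->]]].
- rewrite in_setC1 => wr /set2_inj[[-> ->]|[-> ->]]; first by left.
  by right.
- by exists u; rewrite ?in_setC1.
- by exists v; rewrite ?in_setC1 // setUC.
Qed.

Lemma edges_adj u v : ([set u; v] \in edges G) = G u v.
Proof.
apply/imsetP/idP => [[[a b]]|Guv]; last by exists (u, v); rewrite ?inE.
by rewrite inE /= => Gab /set2_inj[[-> ->]|[-> ->]] //; rewrite adj_sym.
Qed.

Lemma tree_of_spanning f : arborescence f -> tree_of f \in spanning_trees G.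
Proof.
case/and3P=> /eqP frr /forallP Gf /forallP fr; rewrite inE; apply/and3P; split.
- apply/subsetP => A /imsetP[u ur ->]; rewrite edges_adj.
  by apply: (implyP (Gf u)); rewrite -in_setC1.
- have cr u : connect (edge_rel (tree_of f)) u r.
    apply: connect_sub (fr u) => {u} u v /eqP <-.
    have [->|ur] := eqVneq u r; first by rewrite frr connect0.
    by apply: connect1; apply/tree_ofP; left.
  apply/forallP => u; apply/forallP => v; apply: connect_trans (cr u) _.
  by rewrite (sym_connect_sym (edge_rel_sym _)).
apply/acyclicP => c /andP[cc uc]; rewrite leqNgt; apply/negP => c2.
have [rk rkP] := rank_to_root fr.
(* At a vertex of maximal rank on a cycle, both cycle neighbours would have to be its parent,
   although they are distinct. *)
have [u uc0 umax] : exists2 u, u \in c & forall v, v \in c -> (rk v <= rk u)%N.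
  case: c c2 {cc uc} => // x c _.
  have [u ? umax] := @arg_maxnP _ x (mem (x :: c)) rk (mem_head x c).
  by exists u.
have up v : v \in c -> edge_rel (tree_of f) u v -> v = f u.
  move=> vc /tree_ofP[[//]|[/rkP + uE]].
  by rewrite -uE ltnNge umax.
have [i p cE] := rot_to uc0.
move: cc uc; rewrite -(rot_cycle i) -(rot_uniq i).
move: c2; rewrite -(size_rot i) cE.
have sub v : v \in p -> v \in c by move=> vp; rewrite -(mem_rot i) cE inE vp orbT.
case: p sub {cE} => [|a [|b q]] // sub _.
rewrite /cycle rcons_path => /andP[/andP[ua _] lastu].
rewrite !cons_uniq => /and3P[_ + _]; rewrite (up a) ?sub ?mem_head //.
rewrite -(up (last b q)) ?mem_last //; first by rewrite sub // inE mem_last orbT.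
by rewrite edge_rel_sym.
Qed.

(** If f u differs from g u, the edge from u to g u must be a parent edge of f in the other
    direction, so f (g u) = u. Hence f and g also differ at g u, which is closer to [r] along g;
    descending ends at [r], where they agree. *)
Lemma tree_of_inj : {in [pred f : {ffun V -> V} | arborescence f] &,
  injective (fun f : {ffun V -> V} => tree_of f)}.
Proof.
move=> f g /and3P[/eqP frr _ /forallP fr] /and3P[/eqP grr _ /forallP gr] fgE.
have [rkg rkgP] := rank_to_root gr.
have step u : u != r -> f u != g u -> g u != r /\ f (g u) != g (g u).
  move=> ur fg; have : edge_rel (tree_of f) u (g u).
    by rewrite /edge_rel /= fgE; apply/imsetP; exists u; rewrite ?in_setC1.
  case/tree_ofP=> [[_ E]|[gur E]]; first by rewrite E eqxx in fg.
  split=> //; rewrite -E; apply/eqP => E'.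
  have := ltn_trans (rkgP _ gur) (rkgP _ ur).
  by rewrite -E' ltnn.
apply/ffunP => u; have [->|] := eqVneq u r; first by rewrite frr grr.
have [k] := ubnP (rkg u); elim: k u => // k IH u; rewrite ltnS => uk ur.
apply/eqP; apply: contraT => fg; have [gur] := step u ur fg.
by rewrite (IH (g u)) ?eqxx // (leq_trans (rkgP _ ur)).
Qed.

(** Each vertex takes as parent a neighbour in [F] closer to [r]. The resulting tree lies in [F],
    and equals it because a further edge would close a cycle. *)
Lemma spanning_tree_of F : F \in spanning_trees G ->
  exists2 f : {ffun V -> V}, arborescence f & F = tree_of f.
Proof.
rewrite inE => /and3P[/subsetP FG /forallP cF /acyclicP aF].
have H u : exists k, [exists p : k.-tuple V, path (edge_rel F) u p && (last u p == r)].
  have /connectP[p pp pl] := forallP (cF u) r.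
  by exists (size p); apply/existsP; exists (in_tuple p); rewrite pp pl eqxx.
pose dist u := ex_minn (H u).
have step u : u != r -> exists v, edge_rel F u v && (dist v < dist u)%N.
  move=> ur; rewrite {2}/dist; case: ex_minnP => k /existsP[[p /= /eqP <-]] /andP[].
  case: p => [|v p] /=; first by move=> _ /eqP E; rewrite E eqxx in ur.
  case/andP=> uv vp pl _; exists v; rewrite uv ltnS /dist.
  case: ex_minnP => j _; apply; apply/existsP; exists (in_tuple p).
  by rewrite vp.
pose f := [ffun u => if u == r then r else
  odflt r [pick v | edge_rel F u v && (dist v < dist u)%N]].
have frr : f r = r by rewrite ffunE eqxx.
have fP u : u != r -> edge_rel F u (f u) /\ (dist (f u) < dist u)%N.
  move=> ur; rewrite ffunE (negPf ur); case: pickP => [v /andP[]//|no].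
  by have [v] := step u ur; rewrite no.
have af : arborescence f.
  rewrite /arborescence frr eqxx /=; apply/andP; split.
    by apply/forallP => u; apply/implyP => /fP[/FG]; rewrite edges_adj.
  apply/forallP => u; have [k] := ubnP (dist u).
  elim: k u => // k IH u; rewrite ltnS => uk.
  have [->|ur] := eqVneq u r; first exact: connect0.
  apply: connect_trans (fconnect1 f u) (IH _ _).
  by rewrite (leq_trans (fP u ur).2).
have sfF : tree_of f \subset F.
  by apply/subsetP => A /imsetP[u]; rewrite in_setC1 => /fP[uF _] ->.
exists f => //; apply/eqP; rewrite eqEsubset sfF andbT; apply/subsetP => A AF.
have /imsetP[[u v]] := FG A AF; rewrite inE /= => Guv AE; rewrite AE in AF *.
(* The tree path from u to v, closed by the edge uv of [F], is a cycle in [F]; acyclicity reduces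
   this path to the edge itself. *)
have := tree_of_spanning af; rewrite inE => /and3P[_ /forallP/(_ u)/forallP/(_ v)].
case/connectP=> p0 /shortenP[p pp up _] vE _.
have cyc : ucycle (edge_rel F) (u :: p).
  rewrite /ucycle /ucycleb up andbT /= rcons_path -vE; apply/andP; split.
    by apply: sub_path pp => a b; apply: (subsetP sfF).
  by rewrite edge_rel_sym.
have := aF _ cyc; case: p pp vE {up cyc} => [_ uv|w [|//] /=].
  by rewrite uv adj_irrefl in Guv.
by rewrite andbT => uw ->.
Qed.

Lemma tau_arborescences : tau G = #|[pred f : {ffun V -> V} | arborescence f]|.
Proof.
rewrite -(card_in_imset tree_of_inj) /tau; congr #|pred_of_set _|.
apply/setP => F; apply/idP/imsetP => [/spanning_tree_of[f]|[f ? ->]].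
  by exists f.
exact: tree_of_spanning.
Qed.

(* The Laplacian with the row and the column of r replaced by those of the
   identity; its determinant is the principal minor at r. *)
Definition rlaplacian (R : nzRingType) (u v : V) : R :=
  if u == r then (v == r)%:R else
  if v == r then 0 else (u == v)%:R * (deg G u)%:R - (G u v)%:R.

(** Row u other than [r] is the sum over the neighbours k of u of e_u - e_k, with e_r dropped.
    Expanding all rows picks a neighbour f u for every u, and the determinant of a choice is 1 for
    an arborescence and 0 otherwise. *)
Theorem matrix_tree (R : idomainType) : \det (fmx (@rlaplacian R)) = (tau G)%:R.
Proof.
(* In row [r] only the choice k = r has nonzero weight, which forces f r = r. *)
pose c u k : R := (if u == r then k == r else G u k)%:R.
rewrite (eq_fmx (H := fun u v => \sum_k c u k *
   ((u == v)%:R - ((k != r) && (v == k))%:R))); last first.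
  move=> u v; rewrite /rlaplacian /c; have [->|ur] := eqVneq u r.
    rewrite (bigD1 r) //= eqxx big1 ?addr0; last first.
      by move=> k kr; rewrite (negPf kr) mul0r.
    by rewrite mul1r subr0 eq_sym.
  under eq_bigr => k _ do rewrite mulrBr.
  rewrite sumrB -mulr_suml [X in _ = _ - X](bigD1 v) //= eqxx andbT.
  rewrite [X in _ = _ - (_ + X)]big1 ?addr0; last first.
    by move=> k kv; rewrite [v == k]eq_sym (negPf kv) andbF mulr0.
  have [->|vr] := eqVneq v r; first by rewrite (negPf ur) !mulr0 subrr.
  rewrite mulr1 mulrC; congr (_ * _ - _).
  rewrite -natr_sum; congr _%:R; rewrite /deg -sum1_card big_mkcond.
  by apply: eq_bigr => k _; rewrite inE; case: (G u k).
rewrite det_fmx_sum_rows tau_arborescences -[in RHS]sum1_card natr_sum [RHS]big_mkcond /=.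
apply: eq_bigr => f _; rewrite /c.
case: (boolP (f r == r)) => [/eqP frr|frr]; last first.
  by rewrite (bigD1 r) //= eqxx (negPf frr) !mul0r inE /arborescence (negPf frr).
rewrite det_functional // inE /arborescence frr eqxx /=.
case: (boolP [forall u, _ ==> _]) => [/forallP Gf|].
  rewrite big1 ?mul1r; first by case: [forall u, fconnect f u r].
  move=> u _; have [->|ur] := eqVneq u r; first by rewrite frr eqxx.
  by rewrite (implyP (Gf u)).
rewrite negb_forall => /existsP[u]; rewrite negb_imply => /andP[ur Gu].
by rewrite (bigD1 u) //= (negPf ur) (negPf Gu) !mul0r.
Qed.

End MatrixTree.

(** * Helmert vectors and majorization *)

Section Helmert.
Variable R : realFieldType.
Implicit Types (a : nat -> bool) (m l : nat).

(* The Helmert vector w_k plus the constant 1, so that it vanishes at the root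
   x_0 as soon as k > 0. *)
Definition helmert (k i : nat) : R :=
  if (i < k)%N then 0 else if i == k then k.+1%:R else 1.

Definition prefix_count a l : nat := \sum_(i < l) a i.

(* For l = 0 the division by zero makes this 0, which is the value needed. *)
Definition defect a m l : R :=
  ((prefix_count a m)%:R - (prefix_count a l)%:R) / (prefix_count a m)%:R
  * ((l%:R - (prefix_count a l)%:R) / l%:R).

Lemma prefix_countS a l : prefix_count a l.+1 = (prefix_count a l + a l)%N.
Proof. by rewrite /prefix_count big_ord_recr. Qed.

Lemma prefix_count_le a l : (prefix_count a l <= l)%N.
Proof.
elim: l => [|l IH]; first by rewrite /prefix_count big_ord0.
by rewrite prefix_countS -addn1 leq_add // leq_b1.
Qed.

Lemma prefix_count_mono a : {homo prefix_count a : l m / (l <= m)%N}.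
Proof.
by apply: homo_leq => [//|? ? ?|l]; [exact: leq_trans|rewrite prefix_countS leq_addr].
Qed.

Lemma prefix_count_down a m k : (forall i j, (i <= j < m)%N -> a j -> a i) ->
  (k < m)%N -> prefix_count a k = if a k then k else prefix_count a m.
Proof.
move=> down km; case: ifP => ak.
  rewrite /prefix_count -[RHS]card_ord -sum1_card; apply: eq_bigr => i _.
  by rewrite (down i k) // ltnW /=.
rewrite /prefix_count -!(big_mkord xpredT (fun i => nat_of_bool (a i))).
rewrite [RHS](big_cat_nat (leq0n k) (ltnW km)) /= [X in (_ + X)%N]big_nat.
rewrite [X in (_ + X)%N]big1 ?addn0 // => i /andP[ki im].
apply/eqP; rewrite eqb0; apply/negP => ai.
by rewrite (down k i) ?ki in ak.
Qed.

Lemma down_ltE a m k : (forall i j, (i <= j < m)%N -> a j -> a i) ->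
  (k < m)%N -> a k = (k < prefix_count a m)%N.
Proof.
move=> down km; have := prefix_count_down down km; case: (boolP (a k)) => ak cE.
  by rewrite (leq_trans _ (prefix_count_mono a km)) // prefix_countS ak cE addn1.
by rewrite ltnNge -cE prefix_count_le.
Qed.

Lemma defect0 a m : defect a m 0 = 0.
Proof. by rewrite /defect invr0 !mulr0. Qed.

Lemma defectT a m : defect a m m = 0.
Proof. by rewrite /defect subrr !mul0r. Qed.

Lemma defect_ge0 a m l : (l <= m)%N -> 0 <= defect a m l.
Proof.
move=> lm; rewrite !mulr_ge0 ?invr_ge0 ?ler0n // subr_ge0 ler_nat.
  exact: prefix_count_mono.
exact: prefix_count_le.
Qed.

Lemma defect_eq0 a m l : (l < m)%N -> defect a m l = 0 -> a l ->
  forall i, (i < l)%N -> a i.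
Proof.
move=> lm /eqP + al i il.
have lt : (prefix_count a l < prefix_count a m)%N.
  apply: leq_trans (prefix_count_mono a lm).
  by rewrite prefix_countS al addn1.
rewrite /defect !mulf_eq0 !invr_eq0 !pnatr_eq0 !subr_eq0 !eqr_nat.
rewrite (gtn_eqF lt) (gtn_eqF (leq_ltn_trans (leq0n _) lt)).
rewrite (gtn_eqF (leq_ltn_trans (leq0n _) il)) !orbF orFb => /eqP cl.
(* A gap at i leaves at most i + (l - i - 1) elements below l. *)
apply: contraT => ai; suff : (prefix_count a l < l)%N by rewrite -cl ltnn.
rewrite (leq_trans (n := (i + (l - i.+1)).+1)) //; last first.
  by rewrite -addSn subnKC.
rewrite ltnS /prefix_count -(big_mkord xpredT (fun i => nat_of_bool (a i))).
rewrite (big_cat_nat _ (ltnW il)) //= leq_add //.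
  by rewrite big_mkord prefix_count_le.
rewrite big_ltn // (negPf ai) add0n -[X in (_ <= X)%N]muln1 -sum_nat_const_nat.
by apply: leq_sum => j _; rewrite leq_b1.
Qed.

(** The powers 1 and 2 give the two moments that enter the variance below. *)
Lemma sum_helmert a m k p : (k < m)%N -> (0 < p)%N ->
  \sum_(i < m) (a i)%:R * helmert k i ^+ p =
  k.+1%:R ^+ p * (a k)%:R
  + ((prefix_count a m)%:R - (prefix_count a k)%:R - (a k)%:R).
Proof.
move=> km p0; rewrite /prefix_count.
rewrite -(big_mkord xpredT (fun i => (a i)%:R * helmert k i ^+ p)).
rewrite -!(big_mkord xpredT (fun i => nat_of_bool (a i))).
rewrite !(big_cat_nat (leq0n k) (ltnW km)) /= !(big_ltn km) !natrD.
rewrite big_nat big1 => [|i /andP[_ ik]]; last first.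
  by rewrite /helmert ik expr0n eqn0Ngt p0 mulr0.
rewrite {1}/helmert ltnn eqxx !natr_sum.
rewrite [X in _ + (_ + X) = _](eq_big_nat _ _ (F2 := fun i => (a i)%:R)).
  by ring.
move=> i /andP[ki _].
by rewrite /helmert ltnNge (ltnW ki) /= gtn_eqF // expr1n mulr1.
Qed.

(** The left side is the squared norm of the projection of w_k onto the mean-zero functions on the
    set coded by [a]; adding the constant 1 to w_k does not change it. The factor k (k + 1) is
    |w_k|^2. *)
Lemma helmert_variance a m k : (0 < k < m)%N -> (0 < prefix_count a m)%N ->
  \sum_(i < m) (a i)%:R * helmert k i ^+ 2
    - (\sum_(i < m) (a i)%:R * helmert k i) ^+ 2 / (prefix_count a m)%:R
  = k%:R * k.+1%:R * ((a k)%:R - defect a m k + defect a m k.+1).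
Proof.
case/andP=> k0 km s0.
have := @sum_helmert a m k 1 km isT.
under eq_bigr => i _ do rewrite expr1.
rewrite expr1 => ->; rewrite sum_helmert //.
rewrite /defect prefix_countS natrD -[k.+1]addn1 natrD.
have sn : (prefix_count a m)%:R != 0 :> R by rewrite pnatr_eq0 -lt0n.
have kn : k%:R != 0 :> R by rewrite pnatr_eq0 -lt0n.
have k1 : k%:R + 1 != 0 :> R by rewrite natr1 pnatr_eq0.
by case: (a k) => /=; rewrite ?mulr0n ?mulr1n; field; rewrite ?sn ?kn ?k1.
Qed.

(** Each vertex of Y thus contributes 1 at index 0, which makes delta_0 equal to n. *)
Lemma helmert_first a m : (0 < prefix_count a m)%N ->
  (a 0)%:R - defect a m 0 + defect a m 1 = 1.
Proof.
move=> s0; rewrite defect0 subr0 /defect.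
have -> : prefix_count a 1 = a 0 by rewrite prefix_countS /prefix_count big_ord0.
have sn : (prefix_count a m)%:R != 0 :> R by rewrite pnatr_eq0 -lt0n.
by case: (a 0) => /=; rewrite ?mulr0n ?mulr1n; field.
Qed.

(* W k is the difference of the tails (sums over indices >= k) of the sequences
   d and d k - W k + W k.+1. *)
Lemma prod_le_of_tails m (d W : nat -> R) :
  (forall k, (k < m)%N -> 0 < d k) ->
  (forall k, (k.+1 < m)%N -> d k.+1 <= d k) ->
  W 0 = 0 -> W m = 0 -> (forall k, (k <= m)%N -> 0 <= W k) ->
  (forall k, (k < m)%N -> 0 <= d k - W k + W k.+1) ->
  \prod_(k < m) (d k - W k + W k.+1) <= \prod_(k < m) d k /\
  (\prod_(k < m) (d k - W k + W k.+1) = \prod_(k < m) d k ->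
   forall k, (k <= m)%N -> W k = 0).
Proof.
case: m => [|m].
  move=> _ _ W0 _ _ _; rewrite !big_ord0; split=> // _ k.
  by rewrite leqn0 => /eqP ->.
move=> d0 dmon W0 Wm Wge0 dW.
(* The ratios of the two sequences: their mean will be at most 1, so AM-GM bounds their product by
   1. *)
pose E (k : 'I_m.+1) := (d k - W k + W k.+1) / d k.
have Ege0 (k : 'I_m.+1) : 0 <= E k by rewrite divr_ge0 ?dW ?ltW ?d0.
have EE (k : 'I_m.+1) : E k = 1 + (W k.+1 - W k) / d k.
  by rewrite /E; field; rewrite lt0r_neq0 ?d0.
(* Abel summation: as [d] decreases, replacing [d l] by [d l.+1] under the nonnegative [W l.+1] only
   increases the bound, and the sum telescopes. At the last index the bound is 0 because W vanishes
   at the end. *)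
have sumW l : (l < m.+1)%N ->
    \sum_(k < l.+1) (W k.+1 - W k) / d k <= W l.+1 / d l.
  elim: l => [|l IH] lm; first by rewrite big_ord1 W0 subr0.
  rewrite big_ord_recr /=; have := IH (ltnW lm) => {}IH.
  have : W l.+1 / d l <= W l.+1 / d l.+1.
    by rewrite ler_wpM2l ?Wge0 1?ltnW // lef_pV2 ?dmon ?posrE ?d0 // ltnW.
  by rewrite mulrBl; lra.
have sumE : \sum_k E k <= m.+1%:R.
  rewrite (eq_bigr _ (fun k _ => EE k)) big_split /= sumr_const card_ord.
  by rewrite gerDl (le_trans (sumW m _)) // Wm mul0r.
have AGM := @leif_AGM R 'I_m.+1 predT E (fun k _ => Ege0 k).
have cE : #|predT : {pred 'I_m.+1}| = m.+1 by rewrite cardT size_enum_ord.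
rewrite cE in AGM.
have mu1 : (\sum_(i in predT) E i) / m.+1%:R <= 1.
  by rewrite ler_pdivrMr ?ltr0n // mul1r.
have mu0 : 0 <= (\sum_(i in predT) E i) / m.+1%:R.
  by rewrite divr_ge0 ?ler0n // sumr_ge0.
have prE : \prod_(k < m.+1) (d k - W k + W k.+1) =
           \prod_(k < m.+1) E k * \prod_(k < m.+1) d k.
  rewrite -big_split /=; apply: eq_bigr => k _.
  by rewrite /E mulfVK // lt0r_neq0 ?d0.
have dpos : 0 < \prod_(k < m.+1) d k by apply: prodr_gt0 => k _; apply: d0.
have AGMle : \prod_(k < m.+1) E k <= 1.
  by rewrite (le_trans AGM.1) // exprn_ile1.
split; first by rewrite prE ler_piMl // ltW.
rewrite prE -[RHS]mul1r => /(mulIf (lt0r_neq0 dpos)) E1.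
(* A product equal to 1 forces equality in AM-GM, so all ratios coincide; each is then 1, and W
   stays at its initial value 0. *)
have allE : forall i j : 'I_m.+1, E i = E j.
  have : (\prod_(i in predT) E i == ((\sum_(i in predT) E i) / m.+1%:R) ^+ m.+1).
    rewrite eq_le AGM.1 /=; apply: le_trans (exprn_ile1 _ mu0 mu1) _.
    by rewrite E1.
  rewrite AGM.2 => /forallP H i j.
  by have /forallP/(_ j)/eqP := H i.
have E1' (i : 'I_m.+1) : E i = 1.
  apply/eqP; rewrite -(@pexpr_eq1 _ _ m.+1) // -E1.
  rewrite (eq_bigr _ (fun k _ => allE k i)) prodr_const.
  by rewrite cardT size_enum_ord.
elim=> // k IH km; have := E1' (Ordinal km); rewrite EE /= IH ?(ltnW km) // subr0.
move/eqP; rewrite -subr_eq0 addrAC subrr add0r mulf_eq0 invr_eq0.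
by rewrite [d k == 0]gt_eqF ?d0 // orbF => /eqP.
Qed.

End Helmert.

(** * Test functions *)

Lemma sum_eq1l (R : nzRingType) (T : finType) (u : T) (F : T -> R) :
  \sum_v (v == u)%:R * F v = F u.
Proof.
rewrite (bigD1 u) //= eqxx mul1r big1 ?addr0 // => v vu.
by rewrite (negPf vu) mul0r.
Qed.

Lemma sum_pred_natr (R : nzRingType) (T : finType) (P : pred T) (F : T -> R) :
  \sum_(v | P v) F v = \sum_v (P v)%:R * F v.
Proof.
by rewrite big_mkcond; apply: eq_bigr => v _; case: (P v); rewrite ?mul1r ?mul0r.
Qed.

(** The product of k (k + 1) for 1 <= k <= m is m! (m + 1)!; the extra factor m + 1 completes the
    square, and [delta 0] fills the place of the root. *)
Lemma prod_helmert_diag (R : comNzRingType) m (delta : nat -> R) :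
  m.+1%:R * delta 0 * \prod_(i < m.+1)
    (if i == 0%N :> nat then 1 else i%:R * i.+1%:R * delta i) =
  (\prod_(i < m.+1) i.+1%:R) ^+ 2 * \prod_(i < m.+1) delta i.
Proof.
rewrite expr2 {1}[\prod_(i < m.+1) i.+1%:R]big_ord_recr.
rewrite [\prod_(i < m.+1) i.+1%:R]big_ord_recl.
rewrite ![in RHS](big_ord_recl m (fun i => delta i)) [in LHS]big_ord_recl /=.
by rewrite !big_split /=; ring.
Qed.

(** * The Dirichlet form of the reduced Laplacian *)

Section Dirichlet.
Variables (V : finType) (G : sgraph V) (r : V) (R : realFieldType).
Implicit Type g : V -> R.

Lemma degE v : (deg G v)%:R = \sum_(w | G v w) (1 : R).
Proof.
by rewrite /deg -sum1_card natr_sum; apply: eq_bigl => w; rewrite inE.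
Qed.

Lemma sum_nbr_sub g v c :
  \sum_(w | G v w) (c - g w) = (deg G v)%:R * c - \sum_(w | G v w) g w.
Proof. by rewrite sumrB degE mulr_suml; under [in RHS]eq_bigr do rewrite mul1r. Qed.

(** Removing row and column [r] imposes a Dirichlet condition: away from [r] the matrix acts as the
    full Laplacian on [g] set to 0 at [r]. *)
Lemma rlaplacianE g v : \sum_w rlaplacian G r R v w * g w =
  if v == r then g r else
  \sum_(w | G v w) ((if v == r then 0 else g v) - if w == r then 0 else g w).
Proof.
rewrite /rlaplacian; have [_|vr] := eqVneq v r; first exact: sum_eq1l.
rewrite sum_nbr_sub [X in _ - X]sum_pred_natr -(sum_eq1l v (fun w => (deg G v)%:R * g w)).
rewrite -sumrB; apply: eq_bigr => w _.
have [->|_] := eqVneq w r; last by rewrite [v == w]eq_sym; ring.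
by rewrite [r == v]eq_sym (negPf vr) !mul0r mulr0 subrr.
Qed.

(** Symmetrizing in v and w, twice the sum is the sum of (g v - g w)^2 over ordered adjacent
    pairs. *)
Lemma dirichlet_ge0 g : 0 <= \sum_v g v * \sum_(w | G v w) (g v - g w).
Proof.
set S := \sum_v _.
have SE : S = \sum_v \sum_w (G v w)%:R * (g v * (g v - g w)).
  apply: eq_bigr => v _; rewrite sum_pred_natr mulr_sumr.
  by apply: eq_bigr => w _; ring.
have SE' : S = \sum_v \sum_w (G v w)%:R * (g w * (g w - g v)).
  rewrite SE exchange_big; apply: eq_bigr => v _; apply: eq_bigr => w _.
  by rewrite adj_sym.
suff : 0 <= S + S by lra.
rewrite {1}SE SE' -big_split; apply: sumr_ge0 => v _.
rewrite -big_split; apply: sumr_ge0 => w _ /=.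
have -> : (G v w)%:R * (g v * (g v - g w)) + (G v w)%:R * (g w * (g w - g v))
   = (G v w)%:R * (g v - g w) ^+ 2 by ring.
by rewrite mulr_ge0 ?ler0n ?sqr_ge0.
Qed.

Lemma rlaplacian_psd g : 0 <= \sum_v g v * \sum_w rlaplacian G r R v w * g w.
Proof.
under eq_bigr => v _ do rewrite rlaplacianE.
rewrite (bigD1 r) //= eqxx; apply: addr_ge0; first by rewrite -expr2 sqr_ge0.
have := dirichlet_ge0 (fun v => if v == r then 0 else g v).
rewrite (bigD1 r) //= eqxx mul0r add0r; congr (0 <= _).
by apply: eq_bigr => v /negPf vr; rewrite vr.
Qed.

Lemma rlaplacian_sym u v : rlaplacian G r R u v = rlaplacian G r R v u.
Proof.
rewrite /rlaplacian; have [_|ur] := eqVneq u r; have [_|vr] := eqVneq v r => //.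
by rewrite adj_sym [v == u]eq_sym; case: eqVneq => [->//|_]; rewrite !mul0r.
Qed.

End Dirichlet.

(** * Helmert vectors on X, extended harmonically to Y *)

Section TestFunctions.
Variables (V : finType) (G : sgraph V) (X : {set V}) (r : V) (s : seq V).
Variable R : realFieldType.
Hypothesis bip : forall u v, G u v -> (u \in X) = (v \notin X).
Hypothesis deg_gt0 : forall v, (0 < deg G v)%N.
Hypotheses (s_uniq : uniq (r :: s)) (sX : r :: s =i X).

Let m := (size s).+1.
Let x i := nth r (r :: s) i.
Let pos v := index v (r :: s).

Lemma x_in i : (i < m)%N -> x i \in X.
Proof. by move=> im; rewrite -sX mem_nth. Qed.

Lemma pos_x i : (i < m)%N -> pos (x i) = i.
Proof. by move=> im; rewrite /pos index_uniq. Qed.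

Lemma pos_lt v : v \in X -> (pos v < m)%N.
Proof. by rewrite -sX -index_mem. Qed.

Lemma x_pos v : v \in X -> x (pos v) = v.
Proof. by rewrite -sX; apply: nth_index. Qed.

Lemma root_in : r \in X.
Proof. by rewrite -sX mem_head. Qed.

Lemma pos_root : pos r = 0%N.
Proof. by rewrite /pos /= eqxx. Qed.

Lemma pos_eq0 v : (pos v == 0%N) = (v == r).
Proof. by rewrite /pos /= [r == v]eq_sym; case: (v =P r). Qed.

Lemma big_X (T : Type) (idx : T) (op : Monoid.com_law idx) (F : V -> T) :
  \big[op/idx]_(v in X) F v = \big[op/idx]_(i < m) F (x i).
Proof.
rewrite -(eq_bigl _ _ sX) -big_uniq // (big_nth r) big_mkord.
by [].
Qed.

Lemma big_V (T : Type) (idx : T) (op : Monoid.com_law idx) (F : V -> T) :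
  \big[op/idx]_v F v =
  op (\big[op/idx]_(i < m) F (x i)) (\big[op/idx]_(v | v \notin X) F v).
Proof. by rewrite (bigID (mem X)) /= big_X. Qed.

Definition nbr v i : bool := G v (x i).

Lemma sum_nbrY y (F : V -> R) : y \notin X ->
  \sum_(v | G y v) F v = \sum_(i < m) (nbr y i)%:R * F (x i).
Proof.
move=> yX; rewrite -(big_X _ (fun v => (G y v)%:R * F v)) sum_pred_natr.
rewrite [LHS](bigID (mem X)) /= [X in _ + X]big1 ?addr0 // => v vX.
case: (boolP (G y v)) => [/bip|_]; last by rewrite mul0r.
by rewrite vX (negPf yX).
Qed.

Lemma sum_nbrX v (F : V -> R) : v \in X ->
  \sum_(y | G v y) F y = \sum_(y | y \notin X) (G v y)%:R * F y.
Proof.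
move=> vX; rewrite sum_pred_natr [LHS](bigID (mem X)) /= big1 ?add0r // => y yX.
by case: (boolP (G v y)) => [/bip|_]; rewrite ?mul0r // vX yX.
Qed.

Lemma prefix_count_deg y : y \notin X -> prefix_count (nbr y) m = deg G y.
Proof.
move=> yX; apply/eqP; rewrite -(eqr_nat R) natr_sum degE sum_nbrY //.
by apply/eqP; apply: eq_bigr => i _; rewrite mulr1.
Qed.

(* Off X the value is the average over the neighbours: this harmonic extension
   makes the full Laplacian act as its Schur complement onto X. *)
Definition test (u v : V) : R :=
  if (u \in X) && (u != r) then
    if v \in X then helmert R (pos u) (pos v)
    else (\sum_(w | G v w) helmert R (pos u) (pos w)) / (deg G v)%:R
  else (v == u)%:R.

(** Helmert vectors live on their own and later positions, and their extensions spill onto Y;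
    ranking late positions low and Y lowest makes [test] triangular. *)
Definition test_rank v : nat := if v \in X then (m - pos v)%N else 0%N.

Lemma test_trig u v : test u v != 0 -> u = v \/ (test_rank v < test_rank u)%N.
Proof.
rewrite /test /test_rank; case: (boolP (_ && _)) => [/andP[uX ur]|_]; last first.
  by case: (eqVneq v u) => [->|]; [left|rewrite eqxx].
rewrite uX; case: (boolP (v \in X)) => vX; last by right; rewrite subn_gt0 pos_lt.
rewrite /helmert; case: ltnP; rewrite ?eqxx // => puv.
case: (eqVneq (pos v) (pos u)) => [e _|ne _]; first by left; rewrite -(x_pos uX) -e x_pos.
by right; rewrite ltn_sub2l ?pos_lt // ltn_neqAle eq_sym ne.
Qed.

Lemma det_test : \det (fmx test) = \prod_(i < m) i.+1%:R.
Proof.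
rewrite (det_fmx_trig test_trig) big_V /= [X in _ * X]big1 ?mulr1; last first.
  by move=> y yX; rewrite /test (negPf yX) eqxx.
apply: eq_bigr => i _; rewrite /test x_in //= -pos_eq0 pos_x //.
by case: eqVneq => [->|_] /=; rewrite ?eqxx ?/helmert ?ltnn ?eqxx.
Qed.

Lemma test_root u : u \in X -> u != r -> test u r = 0.
Proof.
by move=> uX ur; rewrite /test uX ur root_in /helmert pos_root lt0n pos_eq0 ur.
Qed.

(** The averages on Y make the Laplacian vanish there; at the root, the identity row returns the
    value of the test function, which is 0. *)
Lemma laplacian_test u v : u \in X -> u != r ->
  \sum_w rlaplacian G r R v w * test u w =
  if v \in X then if v == r then 0 else \sum_(w | G v w) (test u v - test u w)
  else 0.
Proof.
move=> uX ur; rewrite rlaplacianE; have [->|vr] := eqVneq v r.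
  by rewrite root_in test_root.
have -> : \sum_(w | G v w) (test u v - (if w == r then 0 else test u w)) =
          \sum_(w | G v w) (test u v - test u w).
  apply: eq_bigr => w _; case: eqVneq => [->|//].
  by rewrite test_root.
case: ifP => // /negbT vX; rewrite sum_nbr_sub.
have dv : (deg G v)%:R != 0 :> R by rewrite pnatr_eq0 -lt0n.
rewrite {1}/test uX ur (negPf vX) /= mulrC mulfVK //.
apply/eqP; rewrite subr_eq0; apply/eqP; apply: eq_bigr => w /bip.
by rewrite (negPf vX) /test uX ur => /esym/negbFE ->.
Qed.

Definition form u v : R := \sum_w test u w * \sum_z rlaplacian G r R w z * test v z.

Lemma form_fmx : fmx form = fmx test *m fmx (rlaplacian G r R) *m (fmx test)^T.
Proof. by rewrite -mulmxA tr_fmx !mul_fmx. Qed.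

Lemma form_root : form r r = 1.
Proof.
rewrite /form /test eqxx andbF sum_eq1l rlaplacianE.
by rewrite eqxx.
Qed.

Lemma form_Y y : y \notin X -> form y y = (deg G y)%:R.
Proof.
move=> yX; rewrite /form /test (negPf yX) /= sum_eq1l.
under eq_bigr do rewrite mulrC.
have yr : y != r by apply: contraNneq yX => ->; rewrite root_in.
by rewrite sum_eq1l /rlaplacian (negPf yr) eqxx adj_irrefl mul1r subr0.
Qed.

(** Only X contributes, by harmonicity on Y. Grouping the edges by their end y leaves the sum of
    squares over N(y) minus the squared sum divided by deg y, the quantity in [helmert_variance]. *)
Lemma form_X u : u \in X -> u != r ->
  form u u = \sum_(y | y \notin X) ((pos u)%:R * (pos u).+1%:R *
    ((nbr y (pos u))%:R - defect R (nbr y) m (pos u)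
     + defect R (nbr y) m (pos u).+1)).
Proof.
move=> uX ur; rewrite /form big_V /= [X in _ + X]big1 ?addr0; last first.
  by move=> y yX; rewrite laplacian_test // (negPf yX) mulr0.
transitivity (\sum_(i < m) \sum_(y | y \notin X)
   (nbr y i)%:R * (test u (x i) ^+ 2 - test u (x i) * test u y)).
  apply: eq_bigr => i _; rewrite laplacian_test // x_in //.
  rewrite (_ : (if _ then _ else _) = if x i == r then 0 else
     \sum_(y | y \notin X) (nbr y i)%:R * (test u (x i) - test u y)); last first.
    case: ifP => // _; rewrite sum_nbrX ?x_in //.
    by apply: eq_bigr => y _; rewrite /nbr adj_sym.
  have [->|_] := eqVneq (x i) r.
    rewrite test_root // mul0r big1 // => y _.
    by rewrite mul0r expr0n subr0 mulr0.
  by rewrite mulr_sumr; apply: eq_bigr => y _; ring.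
rewrite exchange_big; apply: eq_bigr => y yX.
rewrite -helmert_variance; last 2 first.
- by rewrite lt0n pos_eq0 ur pos_lt.
- by rewrite prefix_count_deg.
have testE (i : 'I_m) : test u (x i) = helmert R (pos u) i.
  by rewrite /test uX ur x_in // pos_x.
have testY : test u y = (\sum_(i < m) (nbr y i)%:R * helmert R (pos u) i) /
    (prefix_count (nbr y) m)%:R.
  rewrite /test uX ur (negPf yX) prefix_count_deg // sum_nbrY //=.
  by congr (_ / _); apply: eq_bigr => i _; rewrite pos_x.
under eq_bigr => i _ do rewrite mulrBr testE.
rewrite sumrB; congr (_ - _).
rewrite expr2 -mulrA -testY mulr_suml; apply: eq_bigr => i _; ring.
Qed.

(** The sum of the degrees of the x_i with i >= k minus the sum of the corresponding delta_i; it is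
    the W of [prod_le_of_tails]. *)
Definition excess k : R := \sum_(y | y \notin X) defect R (nbr y) m k.

Lemma deg_x k : (k < m)%N ->
  (deg G (x k))%:R = \sum_(y | y \notin X) (nbr y k)%:R :> R.
Proof.
move=> km; rewrite degE sum_nbrX ?x_in //; apply: eq_bigr => y _.
by rewrite mulr1 /nbr adj_sym.
Qed.

Lemma spread_sum k : (k < m)%N ->
  \sum_(y | y \notin X) ((nbr y k)%:R - defect R (nbr y) m k
     + defect R (nbr y) m k.+1) = (deg G (x k))%:R - excess k + excess k.+1.
Proof. by move=> km; rewrite big_split sumrB deg_x. Qed.

Lemma spread0 :
  (deg G (x 0))%:R - excess 0 + excess 1 = #|~: X|%:R.
Proof.
rewrite -spread_sum // -sum1_card natr_sum.
rewrite [RHS](eq_bigl (fun y => y \notin X)); last by move=> y; rewrite inE.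
apply: eq_bigr => y yX.
by rewrite helmert_first // prefix_count_deg.
Qed.

(** For k > 0 this is a value of the semidefinite form divided by k (k + 1); for k = 0 it is |Y|. *)
Lemma spread_ge0 k : (k < m)%N ->
  0 <= (deg G (x k))%:R - excess k + excess k.+1.
Proof.
move=> km; have [->|k0] := posnP k; first by rewrite spread0 ler0n.
have ur : x k != r by rewrite -pos_eq0 pos_x // -lt0n.
have : 0 <= form (x k) (x k) by apply: rlaplacian_psd.
rewrite form_X ?x_in // pos_x // -mulr_sumr spread_sum //.
by rewrite pmulr_rge0 // mulr_gt0 ?ltr0n.
Qed.

(** Hadamard's inequality in the basis [test] bounds (m!)^2 tau by the product of the diagonal
    values of [form]; [prod_helmert_diag] lets (m!)^2 cancel. *)
Lemma tau_le_spread :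
  m%:R * #|~: X|%:R * (tau G)%:R <=
  \prod_(k < m) ((deg G (x k))%:R - excess k + excess k.+1)
  * \prod_(y | y \notin X) (deg G y)%:R.
Proof.
have := hadamard_fmx test (rlaplacian_sym G r R) (rlaplacian_psd G r (R := R)).
rewrite matrix_tree det_test -[X in _ <= X]/(\prod_u form u u) big_V /=.
rewrite [X in _ <= _ * X](eq_bigr _ form_Y).
pose delta k := (deg G (x k))%:R - excess k + excess k.+1.
have phiE (k : 'I_m) : form (x k) (x k) =
    if k == 0%N :> nat then 1 else k%:R * k.+1%:R * delta k.
  case: eqVneq => [->|k0]; first by rewrite form_root.
  rewrite form_X ?x_in // -?pos_eq0 pos_x //.
  by rewrite -mulr_sumr spread_sum.
rewrite (eq_bigr _ (fun k _ => phiE k)).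
set Q := \prod_(i < m) _; set Phi := \prod_(i < m) _; set D := \prod_(y | _) _.
have Q0 : 0 < Q ^+ 2 by rewrite exprn_gt0 // prodr_gt0 // => i _; rewrite ltr0n.
have := prod_helmert_diag (size s) delta; rewrite -/m -/Q -/Phi {1}/delta spread0 => PhiE le.
rewrite -(ler_pM2l Q0) [X in _ <= X]mulrA -PhiE.
have := ler_wpM2l (mulr_ge0 (ler0n R m) (ler0n R #|~: X|)) le.
by congr (_ <= _); ring.
Qed.

Lemma tau_le_prod_deg :
  sorted (fun u v => deg G v <= deg G u)%N (r :: s) ->
  m%:R * #|~: X|%:R * (tau G)%:R <= \prod_v (deg G v)%:R :> R /\
  (m%:R * #|~: X|%:R * (tau G)%:R = \prod_v (deg G v)%:R :> R ->
   forall y, y \notin X -> forall i j, (i <= j < m)%N -> nbr y j -> nbr y i).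
Proof.
move=> /(sortedP r) srt.
have W_ge0 k : (k <= m)%N -> 0 <= excess k.
  by move=> km; apply: sumr_ge0 => y _; apply: defect_ge0.
have [||||||le eqW] := @prod_le_of_tails R m (fun k => (deg G (x k))%:R) excess.
- by move=> k _; rewrite ltr0n.
- by move=> k km; rewrite ler_nat; apply: srt.
- by rewrite /excess big1 // => y _; rewrite defect0.
- by rewrite /excess big1 // => y _; rewrite defectT.
- exact: W_ge0.
- exact: spread_ge0.
have tle := tau_le_spread.
rewrite big_V /=; set D := \prod_(y | _) _ in tle *.
have D0 : 0 < D by apply: prodr_gt0 => y _; rewrite ltr0n.
split=> [|tE]; first by apply: le_trans tle _; rewrite ler_pM2r.
move=> y yX i j /andP[ij jm] yj; have [->//|ne] := eqVneq i j.
have W0 : excess j = 0.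
  apply: eqW (ltnW jm); apply/eqP; rewrite eq_le le /= -(ler_pM2r D0).
  by rewrite -tE.
(* The vanishing excess is a sum of nonnegative defects, so the defect of every y is 0, which
   excludes gaps before j. *)
have /allP/(_ y) : all (fun y => (y \notin X) ==> (defect R (nbr y) m j == 0))
    (index_enum V).
  rewrite -psumr_eq0 ?W0 // => [|z _]; first exact/eqP.
  by apply: defect_ge0; apply: ltnW.
rewrite mem_index_enum yX => /(_ isT)/eqP/(defect_eq0 jm)/(_ yj); apply.
by rewrite ltn_neqAle ne.
Qed.

(** When all N(y) are initial segments, the Gram matrix of the test functions is triangular, so its
    determinant is the product of its diagonal and Hadamard's inequality becomes an equality. *)
Lemma tau_prefix : (forall y, y \notin X -> forall i j, (i <= j < m)%N ->
    nbr y j -> nbr y i) ->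
  m%:R * #|~: X|%:R * (tau G)%:R = \prod_v (deg G v)%:R :> R.
Proof.
move=> pre.
(* Since [helmert] minus 1 is w_k, this is the eigenvector equation with eigenvalue deg u, at all
   positions except the root. *)
have lapE u i : u \in X -> u != r -> (i < m)%N -> (0 < i)%N ->
    \sum_z rlaplacian G r R (x i) z * test u z =
    (deg G u)%:R * (helmert R (pos u) i - 1).
  move=> uX ur im i0; rewrite laplacian_test // x_in // -pos_eq0 pos_x //.
  rewrite gtn_eqF // sum_nbrX ?x_in //.
  have -> : (deg G u)%:R = \sum_(y | y \notin X) (nbr y (pos u))%:R :> R.
    by rewrite -deg_x ?pos_lt // x_pos.
  rewrite mulr_suml.
  apply: eq_bigr => y yX; rewrite adj_sym -/(nbr y i).
  rewrite /test uX ur x_in // (negPf yX) /= pos_x // sum_nbrY //.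
  under [X in X / _]eq_bigr => j _ do rewrite pos_x //.
  have := @sum_helmert R (nbr y) m (pos u) 1 (pos_lt uX) isT.
  under [X in X = _ -> _]eq_bigr => j _ do rewrite expr1.
  move=> ->; rewrite (prefix_count_down (pre y yX) (pos_lt uX)) prefix_count_deg // expr1 /=.
  have dy : (deg G y)%:R != 0 :> R by rewrite pnatr_eq0 -lt0n.
  (* With k the position of u: if y is adjacent to u, N(y) contains all positions up to k and the
     average is ((k + 1) + (deg y - k - 1)) / deg y = 1. Otherwise N(y) lies below k, where the
     Helmert vector vanishes, and the average is 0. *)
  case: (boolP (nbr y (pos u))) => au /=.
    have -> : (((pos u).+1%:R * 1%:R + ((deg G y)%:R - (pos u)%:R - 1%:R))
      / (deg G y)%:R) = 1 :> R by rewrite -[(pos u).+1]addn1 natrD; field.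
    case: (leqP i (pos u)) => iu.
      by rewrite (pre y yX i (pos u)) ?iu ?pos_lt.
    by rewrite /helmert ltnNge (ltnW iu) /= gtn_eqF // subrr !mulr0.
  rewrite mulr0 add0r subrr sub0r oppr0 mul0r subr0 mul0r.
  case: (boolP (nbr y i)) => ai; last by rewrite mul0r.
  rewrite /helmert; case: ltnP => [_|ui]; first by rewrite mulr0.
  by rewrite (pre y yX (pos u) i) ?ui in au.
have formE u v : u \in X -> u != r -> v \in X -> v != r ->
    form u v = \sum_(i < m) helmert R (pos u) i *
      ((deg G v)%:R * (helmert R (pos v) i - 1)) *+ (0 < i)%N.
  move=> uX ur vX vr; rewrite /form big_V /= [X in _ + X]big1 ?addr0; last first.
    by move=> y yX; rewrite laplacian_test // (negPf yX) mulr0.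
  apply: eq_bigr => i _; have [i0|i0] := posnP i.
    by rewrite mulr0n i0 laplacian_test // x_in // eqxx mulr0.
  by rewrite mulr1n lapE // {1}/test uX ur x_in // pos_x.
(* At least one of the two functions is a unit vector at [r] or in Y. A Helmert test function has
   zero Laplacian there, and two distinct such vertices give a zero entry of the reduced
   Laplacian. *)
have form0 u v : u != v -> ~~ [&& u \in X, u != r, v \in X & v != r] -> form u v = 0.
  move=> uv; case: (boolP ((v \in X) && (v != r))) => [/andP[vX vr]|vXr].
    rewrite !andbT => uXr.
    rewrite /form {1}/test (negPf uXr) sum_eq1l laplacian_test //.
    case: ifP => // uX; rewrite uX negbK in uXr.
    by rewrite uXr.
  move=> _; rewrite /form; under eq_bigr => w _.
    under eq_bigr => z _ do rewrite /test (negPf vXr) mulrC.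
    rewrite sum_eq1l rlaplacian_sym mulrC; over.
  case: (boolP ((u \in X) && (u != r))) => [/andP[uX ur]|uXr].
    rewrite laplacian_test //; case: ifP => // vX; rewrite vX negbK in vXr.
    by rewrite vXr.
  under eq_bigr => w _ do rewrite /test (negPf uXr) mulrC.
  rewrite sum_eq1l /rlaplacian.
  have [vr|vr] := eqVneq v r; first by rewrite -vr (negPf uv).
  have [//|ur] := eqVneq u r; rewrite eq_sym (negPf uv) mul0r.
  rewrite ur andbT in uXr; rewrite vr andbT in vXr.
  case: (boolP (G v u)) => [/bip|_]; last by rewrite subr0.
  by rewrite (negPf vXr) uXr.
have trig u v : form u v != 0 -> u = v \/ (test_rank v < test_rank u)%N.
  have [->|uv fuv] := eqVneq u v; first by left.
  right; have : [&& u \in X, u != r, v \in X & v != r].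
    by apply: contraNT fuv => /(form0 _ _ uv) ->.
  case/and4P=> uX ur vX vr; rewrite /test_rank uX vX.
  apply: contraNT fuv; rewrite formE // -leqNgt => le.
  have lt : (pos v < pos u)%N.
    rewrite ltn_neqAle; apply/andP; split.
      by apply: contra uv => /eqP E; rewrite -(x_pos uX) -E x_pos.
    by rewrite leqNgt; apply: contraTN le => lt; rewrite -ltnNge ltn_sub2l ?pos_lt.
  (* Below the position of u the first factor is 0; from there on, beyond the position of v,
     [helmert] is 1 and the second factor is 0. *)
  apply/eqP/big1 => i _; rewrite /helmert; case: ltnP => iu.
    by rewrite mul0r mul0rn.
  have vi := leq_trans lt iu.
  by rewrite ltnNge (ltnW vi) /= [nat_of_ord i == pos v]gtn_eqF // subrr !mulr0 mul0rn.
(* A nonempty initial segment contains x_0, so deg x_0 = |Y| takes the place of delta_0. *)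
have nbr0 y : y \notin X -> nbr y 0.
  move=> yX; have /card_gt0P[w] := deg_gt0 y; rewrite inE => Gyw.
  have wX : w \in X by have := bip Gyw; rewrite (negPf yX) => /esym/negbFE.
  by apply: (pre y yX 0%N (pos w)); rewrite ?pos_lt // /nbr x_pos.
have deg0 : (deg G (x 0))%:R = #|~: X|%:R :> R.
  rewrite deg_x // -sum1_card natr_sum.
  rewrite [RHS](eq_bigl (fun y => y \notin X)); last by move=> y; rewrite inE.
  by apply: eq_bigr => y /nbr0 ->.
have phiE (k : 'I_m) : form (x k) (x k) =
    if k == 0%N :> nat then 1 else k%:R * k.+1%:R * (deg G (x k))%:R.
  case: eqVneq => [->|k0]; first by rewrite form_root.
  rewrite formE ?x_in // -?pos_eq0 ?pos_x // (bigD1 k) //= lt0n k0 mulr1n.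
  rewrite [X in _ + X]big1 ?addr0 => [|i ik].
    by rewrite /helmert ltnn eqxx -[k.+1]addn1 natrD; ring.
  have ne : (nat_of_ord i == k) = false by apply/negbTE; rewrite -val_eqE in ik.
  by rewrite /helmert ne; case: ifP => _; rewrite ?mul0r ?subrr ?mulr0 mul0rn.
have := det_fmx_trig trig; rewrite form_fmx !det_mulmx det_tr det_test.
rewrite matrix_tree !big_V /= [X in _ = _ * X -> _](eq_bigr _ form_Y).
rewrite (eq_bigr _ (fun k _ => phiE k)).
have := prod_helmert_diag (size s) (fun k => (deg G (x k))%:R : R).
rewrite deg0 -/m; set Phi := (\prod_(i < m) if _ then _ else _).
set Q := \prod_(i < m) _.+1%:R.
set D := \prod_(y | _) _ => PhiE detE.
have Q0 : Q ^+ 2 != 0.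
  by rewrite expf_neq0 //; apply/prodf_neq0 => i _; rewrite pnatr_eq0.
apply: (mulfI Q0); rewrite [RHS]mulrA -PhiE -!mulrA -detE; ring.
Qed.

End TestFunctions.

(** * Ferrers graphs *)

Section Bipartite.
Variables (V : finType) (G : sgraph V) (X Y : {set V}).
Hypotheses (hXY : bipartition G X Y) (hG : connected G).
Hypotheses (X_gt0 : (0 < #|X|)%N) (Y_gt0 : (0 < #|Y|)%N).

Lemma bipartition_setC : Y = ~: X.
Proof.
case: hXY => dis UT _; apply/setP => v; rewrite inE.
have := in_setT v; rewrite -UT inE; have := disjointFr dis (x := v).
by case: (v \in X) => [->|_ /=].
Qed.

Lemma bipartition_inY v : (v \in Y) = (v \notin X).
Proof. by rewrite bipartition_setC inE. Qed.

Lemma bipartition_adj u v : G u v -> (u \in X) = (v \notin X).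
Proof.
case: hXY => _ _ H /H; rewrite bipartition_setC !inE.
by case: (u \in X); case: (v \in X).
Qed.

Lemma connected_deg_gt0 v : (0 < deg G v)%N.
Proof.
have [w wv] : exists w, w != v.
  have /card_gt0P[x xX] := X_gt0; have /card_gt0P[y] := Y_gt0.
  rewrite bipartition_inY => yX.
  have [xv|] := eqVneq x v; last by exists x.
  by exists y; apply: contraNneq yX => ->; rewrite -xv.
have /connectP[[|u p] /=] := forallP (forallP hG v) w.
  by move=> _ E; rewrite E eqxx in wv.
by case/andP=> vu _ _; apply/card_gt0P; exists u; rewrite inE.
Qed.

(** The order of X is kept, Y is sorted by decreasing degree, and t_j is the degree of y_j, since an
    initial segment is determined by its length. *)
Lemma ferrers_of_prefix (r : V) (s : seq V) :
  uniq (r :: s) -> r :: s =i X ->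
  (forall y, y \notin X -> forall i j, (i <= j < (size s).+1)%N ->
     nbr G r s y j -> nbr G r s y i) ->
  ferrers G X Y.
Proof.
move=> us sX pre; set x := nth r (r :: s).
have size_s : size (r :: s) = #|X| by rewrite -(card_uniqP us); apply: eq_card.
pose q := sort (fun u v => deg G v <= deg G u)%N (enum Y).
have size_q : size q = #|Y| by rewrite size_sort -cardE.
have uq : uniq q by rewrite sort_uniq enum_uniq.
have qY v : (v \in q) = (v \in Y) by rewrite mem_sort mem_enum.
have qsorted i j : (i <= j < #|Y|)%N -> (deg G (nth r q j) <= deg G (nth r q i))%N.
  case/andP=> ij jY.
  apply: (sorted_leq_nth (leT := fun u v => (deg G v <= deg G u)%N));
    rewrite ?inE ?size_q ?(leq_ltn_trans ij) //.
  - by move=> a b c; move=> ba ac; apply: leq_trans ac ba.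
  - by apply: sort_sorted => a b; apply: leq_total.
have nbrE y i : y \notin X -> (i < #|X|)%N -> G y (x i) = (i < deg G y)%N.
  rewrite -size_s => yX im; rewrite -(prefix_count_deg rat bipartition_adj us sX yX).
  exact: (down_ltE (pre y yX)).
have yNX (j : 'I_#|Y|) : nth r q j \notin X.
  have : nth r q j \in Y by rewrite -qY mem_nth // size_q.
  by rewrite bipartition_inY.
have degY y : y \notin X -> (deg G y <= #|X|)%N.
  move=> yX; rewrite -(prefix_count_deg rat bipartition_adj us sX yX) -size_s.
  exact: prefix_count_le.
exists (fun i => x i), (fun j => nth r q j), (fun j => deg G (nth r q j)); split.
- split=> [i j /eqP|].
    by rewrite nth_uniq ?size_s // => /eqP; apply: val_inj.
  apply/setP => v; apply/imsetP/idP => [[i _ ->]|vX].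
    by rewrite -sX mem_nth // size_s.
  have iv : (index v (r :: s) < #|X|)%N by rewrite -size_s index_mem sX.
  by exists (Ordinal iv); rewrite //= /x nth_index // sX.
- split=> [i j /eqP|].
    by rewrite nth_uniq ?size_q // => /eqP; apply: val_inj.
  apply/setP => v; apply/imsetP/idP => [[i _ ->]|vY].
    by rewrite -qY mem_nth // size_q.
  have iv : (index v q < #|Y|)%N by rewrite -size_q index_mem qY.
  by exists (Ordinal iv); rewrite //= nth_index // qY.
- move=> j j0; apply/eqP; rewrite eqn_leq degY //=.
  (* Any neighbour of the last vertex of X has all of X as its neighbourhood, so the largest degree
     in Y is |X|. *)
  have lastX : (#|X|.-1 < #|X|)%N by rewrite ltn_predL.
  have /card_gt0P[y] := connected_deg_gt0 (x #|X|.-1); rewrite inE adj_sym => Gy.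
  have yX : y \notin X.
    by rewrite -(bipartition_adj (u := x #|X|.-1)) 1?adj_sym // -sX mem_nth // size_s.
  rewrite nbrE // prednK // in Gy; apply: leq_trans Gy _.
  have yY : y \in q by rewrite qY bipartition_inY.
  rewrite -(nth_index r yY); apply: qsorted.
  by rewrite j0 /= -size_q index_mem.
- split=> [j k jk|j]; first by apply: qsorted; rewrite jk /=.
  exact: connected_deg_gt0.
move=> j; apply/setP => v; rewrite inE; apply/idP/imsetP => [Gyv|[i]].
  have vX : v \in X.
    by have := bipartition_adj Gyv; rewrite (negPf (yNX j)) => /esym/negbFE.
  have iv : (index v (r :: s) < #|X|)%N by rewrite -size_s index_mem sX.
  have vE : v = x (index v (r :: s)) by rewrite /x nth_index // sX.
  by exists (Ordinal iv); rewrite ?inE //= -nbrE // -vE.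
by rewrite inE => it ->; rewrite nbrE.
Qed.

Lemma prefix_of_ferrers : ferrers G X Y ->
  exists r s, [/\ uniq (r :: s), r :: s =i X
    & forall y, y \notin X -> forall i j, (i <= j < (size s).+1)%N ->
        nbr G r s y j -> nbr G r s y i].
Proof.
case=> x [y [t [[x_inj xX] [_ yY] _ _ N]]].
pose q := [seq x i | i <- enum 'I_#|X|].
have size_q : size q = #|X| by rewrite size_map size_enum_ord.
have uq : uniq q by rewrite map_inj_uniq ?enum_uniq.
have qX : q =i X.
  move=> v; rewrite -xX; apply/mapP/imsetP => -[i _ ->]; exists i => //.
  by rewrite mem_enum.
have nth_q r (i : 'I_#|X|) : nth r q i = x i.
  by rewrite (nth_map i) ?size_enum_ord // nth_ord_enum.
case: q size_q uq qX nth_q => [|r s] size_q uq qX nth_q.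
  by have := X_gt0; rewrite -size_q.
exists r, s; split=> // v vX i j.
have : v \in Y by rewrite bipartition_inY.
rewrite -yY => /imsetP[k _ ->]; rewrite -[(size s).+1]/(size (r :: s)) size_q.
case/andP=> ij jX.
have nbrE (l : nat) (lX : (l < #|X|)%N) : nbr G r s (y k) l = (l < t k)%N.
  rewrite /nbr -[X in nth _ _ X]/(nat_of_ord (Ordinal lX)) nth_q.
  have := N k; move/setP/(_ (x (Ordinal lX))); rewrite inE => ->.
  apply/imsetP/idP => [[a + /x_inj la]|lt]; first by rewrite inE -la.
  by exists (Ordinal lX); rewrite ?inE.
have iX := leq_ltn_trans ij jX.
rewrite !nbrE //.
exact: leq_ltn_trans ij.
Qed.

End Bipartite.

Theorem theorem1p2 (V : finType) (G : sgraph V) (X Y : {set V}) (m n : nat)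
    (hXY : bipartition G X Y) (hG : connected G)
    (hX : #|X| = m) (hY : #|Y| = n) (hm : (0 < m)%N) (hn : (0 < n)%N) :
  ((tau G)%:R <= 1 / (m%:R * n%:R) * \prod_(v : V) (deg G v)%:R :> rat) /\
  ((tau G)%:R = 1 / (m%:R * n%:R) * \prod_(v : V) (deg G v)%:R :> rat
     <-> ferrers G X Y).
Proof.
subst m n.
have mn0 : 0 < #|X|%:R * #|Y|%:R :> rat by rewrite mulr_gt0 ?ltr0n.
have adjP := bipartition_adj hXY; have deg_gt0 := connected_deg_gt0 hXY hG hm hn.
rewrite mul1r ler_pdivlMl //.
have -> : ((tau G)%:R = (#|X|%:R * #|Y|%:R)^-1 * \prod_v (deg G v)%:R :> rat) <->
          (#|X|%:R * #|Y|%:R * (tau G)%:R = \prod_v (deg G v)%:R :> rat).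
  split=> [->|<-]; first by rewrite mulVKf ?lt0r_neq0.
  by rewrite mulKf ?lt0r_neq0.
have size_s r s : uniq (r :: s) -> r :: s =i X -> (size s).+1 = #|X|.
  by move=> us sX; rewrite -[LHS]/(size (r :: s)) -(card_uniqP us); apply: eq_card.
(* The head of this list, a vertex of maximal degree in X, serves as the root of the reduced
   Laplacian. *)
pose q := sort (fun u v => deg G v <= deg G u)%N (enum X).
have uq : uniq q by rewrite sort_uniq enum_uniq.
have qX : q =i X by move=> v; rewrite mem_sort mem_enum.
have sq : sorted (fun u v => deg G v <= deg G u)%N q.
  by apply: sort_sorted => a b; apply: leq_total.
case: q uq qX sq => [|r s] us sX srt.
  by have /card_gt0P[v] := hm; rewrite -sX.
have [le eq_down] := tau_le_prod_deg rat adjP deg_gt0 us sX srt.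
rewrite (size_s _ _ us sX) -(bipartition_setC hXY) in le eq_down.
split=> //; split=> [/eq_down pre|/(prefix_of_ferrers hXY hm)[r' [s' [us' sX' pre]]]].
  apply: (ferrers_of_prefix hXY hG hm hn us sX).
  by rewrite (size_s _ _ us sX).
(* Here the root and the order of X come from the Ferrers ordering. *)
have := tau_prefix rat adjP deg_gt0 us' sX' pre.
by rewrite (size_s _ _ us' sX') -(bipartition_setC hXY).
Qed.
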